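(* Let $n\ge1$ and $L>0$. Fix $\alpha\ge3$, $0<s\le1/L$ and $\beta\ge0$, and set $q_{\max}:=sL\in(0,1]$. The following statements are equivalent: (i) For every symmetric positive semidefinite matrix $Q\in\mathbb R^{n\times n}$ satisfying $\|Q\|\le L$, the limiting matrix $A_\infty(\lambda)$ (see context) associated with each positive eigenvalue $\lambda$ of $Q$ is Schur stable. (ii) The parameter satisfies $$\frac{\beta}{\sqrt s}<T(q_{\max}):=\begin{cases}\dfrac{4-3q_{\max}}{2q_{\max}(1-q_{\max})},&0<q_{\max}\le\frac23,\\[2mm] \dfrac92,&\frac23\le q_{\max}\le1.\end{cases}$$ Whenever these conditions hold, for every such fixed matrix $Q$, every $x^\star\in\mathbb R^n$, $f^\star\in\mathbb R$, and every initial pair $x_0,x_1\in\mathbb R^n$, the sequences $(x_k),(y_k)$ generated by IGAHD applied to $f_Q(x)=\frac12\langle Q(x-x^\star),x-x^\star\rangle+f^\star$ satisfy: there exist $C>0$, $\rho\in(0,1)$, $k_0\ge1$ (which may depend on $Q$ and on the initial pair) such that for every $k\ge k_0$, $$0\le f_Q(x_k)-f^\star\le C\rho^{2k},\qquad \|\nabla f_Q(x_k)\|+\|\nabla f_Q(y_k)\|\le C\rho^k;$$ consequently $f_Q(x_k)-f^\star=O(k^{-2})$; $\sum_{k\ge1}k^2\|\nabla f_Q(x_k)\|^2<+\infty$ and $\sum_{k\ge1}k^2\|\nabla f_Q(y_k)\|^2<+\infty$; $\|\nabla f_Q(x_k)\|=o(k^{-1})$ and $\|\nabla f_Q(y_k)\|=o(k^{-1})$;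 $\min_{1\le i\le k}\|\nabla f_Q(x_i)\|^2=O(k^{-3})$ and $\min_{1\le i\le k}\|\nabla f_Q(y_i)\|^2=O(k^{-3})$; and $(x_k)$ converges to a minimizer of $f_Q$.
   Context: $\|Q\|$ is the operator norm induced by the Euclidean norm. A matrix is Schur stable if all its (complex) eigenvalues have modulus less than one. IGAHD for a differentiable $f$: given $x_0,x_1$, for $k\ge1$, $$a_k=1-\frac{\alpha}{k},\qquad y_k=x_k+a_k(x_k-x_{k-1})-\beta\sqrt{s}\,\bigl(\nabla f(x_k)-\nabla f(x_{k-1})\bigr)-\frac{\beta\sqrt{s}}{k}\nabla f(x_{k-1}),\qquad x_{k+1}=y_k-s\nabla f(y_k).$$ Limiting matrix of a spectral mode: for an eigenvalue $\lambda$ of $Q$, put $q=s\lambda$ and $d=\beta\lambda\sqrt{s}$. In an eigencoordinate of $Q$ with eigenvalue $\lambda$, the coordinate $\xi_k$ of $x_k-x^\star$ satisfies $$\begin{pmatrix}\xi_{k+1}\\ \xi_k\end{pmatrix}=A_k(\lambda)\begin{pmatrix}\xi_k\\ \xi_{k-1}\end{pmatrix},\qquad A_k(\lambda)=\begin{pmatrix}(1-q)\left(2-d-\frac{\alpha}{k}\right)&(1-q)\left(-(1-d)+\frac{\alpha-d}{k}\right)\\ 1&0\end{pmatrix},$$ and the limiting matrix is $$A_\infty(\lambda):=\lim_{k\to\infty}A_k(\lambda)=\begin{pmatrix}(1-q)(2-d)&-(1-q)(1-d)\\ 1&0\end{pmatrix}.$$ *)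

(* Defs.v *)
From HB Require Import structures.
From mathcomp Require Import all_boot all_order all_algebra.
From mathcomp Require Import complex.
From mathcomp Require Import all_classical all_reals all_analysis.

Set Implicit Arguments.
Unset Strict Implicit.
Unset Printing Implicit Defensive.

Import Order.TTheory GRing.Theory Num.Theory.
Import numFieldNormedType.Exports.

Local Open Scope classical_set_scope.
Local Open Scope ring_scope.

Definition dotv (R : realType) (n : nat) (u v : 'cV[R]_n) : R :=
  \sum_(i < n) u i 0 * v i 0.

(* The library norm on matrices is the sup norm, hence this separate Euclidean
   norm; the two induce the same topology on column vectors. *)
Definition enorm (R : realType) (n : nat) (u : 'cV[R]_n) : R :=
  Num.sqrt (dotv u u).

(* The set is nonempty and bounded, so that sup is a genuine supremum. *)
Definition opnorm (R : realType) (n : nat) (Q : 'M[R]_n) : R :=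
  sup [set enorm (Q *m v) | v in [set v : 'cV[R]_n | enorm v <= 1]].

Definition psdmx (R : realType) (n : nat) (Q : 'M[R]_n) : Prop :=
  forall v : 'cV[R]_n, 0 <= dotv (Q *m v) v.

Definition schur_stable (R : realType) (m : nat) (A : 'M[R]_m) : Prop :=
  forall z : complex R,
    eigenvalue (map_mx (real_complex R) A) z -> `|z| < 1.

Definition grad (R : realType) (n : nat) (f : 'cV[R]_n -> R) (x : 'cV[R]_n) :
    'cV[R]_n :=
  \col_(i < n) 'D_(delta_mx i 0) f x.

(* y 0 plays no role in the scheme and is left unconstrained. *)
Definition IGAHD (R : realType) (n : nat) (f : 'cV[R]_n -> R)
    (alpha beta s : R) (x0 x1 : 'cV[R]_n) (x y : nat -> 'cV[R]_n) : Prop :=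
  [/\ x 0%N = x0,
      x 1%N = x1 &
      forall k : nat, (1 <= k)%N ->
        y k = x k + (1 - alpha / k%:R) *: (x k - x k.-1)
              - (beta * Num.sqrt s) *: (grad f (x k) - grad f (x k.-1))
              - (beta * Num.sqrt s / k%:R) *: grad f (x k.-1)
        /\ x k.+1 = y k - s *: grad f (y k)].

(* [[a, b], [c, d]], listed by rows *)
Definition mx22 (R : realType) (a b c d : R) : 'M[R]_2 :=
  \matrix_(i < 2, j < 2)
    if i == 0 then (if j == 0 then a else b) else (if j == 0 then c else d).

(* Transition matrix (xi_k, xi_(k-1)) |-> (xi_(k+1), xi_k) of the mode lam. *)
Definition mode_mx (R : realType) (alpha beta s lam : R) (k : nat) : 'M[R]_2 :=
  let q := s * lam in
  let d := beta * lam * Num.sqrt s in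
  mx22 ((1 - q) * (2 - d - alpha / k%:R))
       ((1 - q) * (- (1 - d) + (alpha - d) / k%:R))
       1 0.

Definition mode_mx_lim (R : realType) (alpha beta s lam : R) : 'M[R]_2 :=
  lim (mode_mx alpha beta s lam k @[k --> \oo]).

Lemma cvg_mx22 (R : realType) (a b c d : nat -> R) (a' b' c' d' : R) :
  a k @[k --> \oo] --> a' -> b k @[k --> \oo] --> b' ->
  c k @[k --> \oo] --> c' -> d k @[k --> \oo] --> d' ->
  mx22 (a k) (b k) (c k) (d k) @[k --> \oo] --> mx22 a' b' c' d'.
Proof.
move=> ha hb hc hd; apply/cvgrPdist_lt => e e0.
near=> k; rewrite /Num.norm/= mx_normrE.
apply/bigmax_ltP; split=> // -[i j] _; rewrite !mxE/=.
by case: (i == 0); case: (j == 0); near: k;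
  [move/cvgrPdist_lt: ha|move/cvgrPdist_lt: hb
  |move/cvgrPdist_lt: hc|move/cvgrPdist_lt: hd]; exact.
Unshelve. all: by end_near. Qed.

Lemma cvg_mode_mx (R : realType) (alpha beta s lam : R) :
  let q := s * lam in
  let d := beta * lam * Num.sqrt s in
  mode_mx alpha beta s lam k @[k --> \oo] -->
    mx22 ((1 - q) * (2 - d)) (- ((1 - q) * (1 - d))) 1 0.
Proof.
move=> q d.
have h c : c / k%:R @[k --> \oo] --> (0 : R).
  rewrite -[X in _ --> X](mulr0 c); apply: cvgM; first exact: cvg_cst.
  by apply/gtr0_cvgV0; [exists 1%N => // k /= k1; rewrite ltr0n|exact: cvgr_idn].
apply: cvg_mx22; try exact: cvg_cst.
- apply: cvgM; first exact: cvg_cst.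
  rewrite -[X in _ --> X](subr0 (2 - d)).
  by apply: cvgB; [exact: cvg_cst|exact: h].
- rewrite -(mulrN (1 - q)); apply: cvgM; first exact: cvg_cst.
  rewrite -[X in _ --> X](addr0 (- (1 - d))).
  by apply: cvgD; [exact: cvg_cst|exact: h].
Qed.

Lemma mode_mx_limE (R : realType) (alpha beta s lam : R) :
  let q := s * lam in
  let d := beta * lam * Num.sqrt s in
  mode_mx_lim alpha beta s lam =
    mx22 ((1 - q) * (2 - d)) (- ((1 - q) * (1 - d))) 1 0.
Proof. exact/cvg_lim/cvg_mode_mx. Qed.

(* Both branches have the value 9/2 at q = 2/3. *)
Definition threshold (R : realType) (q : R) : R :=
  if q <= 2 / 3 then (4 - 3 * q) / (2 * q * (1 - q)) else 9 / 2.

Definition quadf (R : realType) (n : nat) (Q : 'M[R]_n) (xstar : 'cV[R]_n)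
    (fstar : R) (x : 'cV[R]_n) : R :=
  1 / 2 * dotv (Q *m (x - xstar)) (x - xstar) + fstar.

(* Minimum of u 1, ..., u k, for k >= 1; the value at k = 0 is irrelevant. *)
Definition running_min (R : realType) (u : nat -> R) (k : nat) : R :=
  \big[Num.min/u 1%N]_(1 <= i < k.+1) u i.

(* Main.v *)
Require Import Defs.
From HB Require Import structures.
From mathcomp Require Import all_boot all_order all_algebra.
From mathcomp Require Import complex.
From mathcomp Require Import all_classical all_reals all_analysis.
From mathcomp Require Import ring lra.

Set Implicit Arguments.
Unset Strict Implicit.
Unset Printing Implicit Defensive.

Import Order.TTheory GRing.Theory Num.Theory.
Import numFieldNormedType.Exports.

Local Open Scope classical_set_scope.
Local Open Scope ring_scope.

(** Why the statement holds.

In a basis that diagonalizes Q ([symmetric_diagonalizable]) the scheme splits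
into independent second order scalar recurrences, one per eigenvalue lam
([IGAHD_mode_scheme]). With q = s lam and d = beta lam sqrt s, the limiting
recurrence has characteristic polynomial z^2 - t z + D with t = (1 - q) (2 - d)
and D = (1 - q) (1 - d). Of the three Jury inequalities, D < 1 and
1 - t + D = q > 0 are automatic when lam > 0, and the third one,
0 < 1 + t + D, reads 2 d (1 - q) < 4 - 3 q ([schur_modeP]). Since
d = (beta / sqrt s) q, it says that beta / sqrt s is below
h(q) = (4 - 3 q) / (2 q (1 - q)). This function decreases until q = 2/3, where it
reaches its minimum 9/2 on (0, 1), so the threshold is the minimum of h over the
attainable q < 1 ([threshold_lower_mode]), while q = 1 imposes nothing; scalar
matrices realize the extremal mode ([schur_uniform_threshold]).

For the convergence, a positive mode obeys a recurrence with coefficients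
tending to those of a Schur stable one. The Schur-Cohn quadratic form for a
circle of radius slightly below 1 contracts along the limit recurrence
([lyap_step]), and still does so after a small perturbation of the coefficients
([lyap_perturb]), whence geometric decay ([perturbed_recurrence_decay]). A
kernel mode satisfies xi_(k+1) - xi_k = (1 - alpha / k) (xi_k - xi_(k-1)) and
converges thanks to the invariant k (xi_(k+1) - xi_k) + (alpha - 1) xi_k
([kernel_mode_cvg]). The gradients involve positive modes only, so they decay
geometrically; the function gap is bounded by a multiple of the squared gradient
norm ([quad_le_grad]); and the limit of x lies in xstar + ker Q, which is the set
of minimizers. All polynomial rates follow from the geometric ones. *)

(** * Jury criterion and threshold *)

Lemma det_mx22 (R : comPzRingType) (A : 'M[R]_2) :
  \det A = A 0 0 * A 1 1 - A 0 1 * A 1 0.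
Proof.
rewrite (expand_det_row _ 0) !big_ord_recl big_ord0 addr0 /cofactor.
rewrite !det_mx11 !mxE /= expr0 mul1r expr1 mulN1r mulrN.
congr (A _ _ * A _ _ - A _ _ * A _ _); exact/val_inj.
Qed.

Lemma eigenvalue_mx22 (F : fieldType) (A : 'M[F]_2) (z : F) :
  eigenvalue A z =
  (z ^+ 2 - (A 0 0 + A 1 1) * z + (A 0 0 * A 1 1 - A 0 1 * A 1 0) == 0).
Proof.
rewrite eigenvalue_root_char /root /char_poly det_mx22 !mxE /= !hornerE /=.
by congr (_ == 0); ring.
Qed.

Lemma eigenvalue_companion (R : realType) (t d : R) (z : complex R) :
  eigenvalue (map_mx (real_complex R) (mx22 t (- d) 1 0)) z =
  (z ^+ 2 - t%:C%C * z + d%:C%C == 0).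
Proof.
rewrite eigenvalue_mx22 !mxE /= rmorphN rmorph1 rmorph0.
by rewrite addr0 mulr0 sub0r mulr1 opprK.
Qed.

Lemma companion_complexE (R : realType) (t d a b : R) :
  (a +i* b)%C ^+ 2 - t%:C%C * (a +i* b)%C + d%:C%C =
  ((a ^+ 2 - b ^+ 2 - t * a + d) +i* (2 * a * b - t * b))%C.
Proof. by rewrite expr2; simpc; congr (_ +i* _)%C; ring. Qed.

(** The Jury criterion for z^2 - t z + d, two of whose three inequalities are
hypotheses. If the polynomial is nonpositive at -1 it has a real root there or
further left. Conversely a non-real root has squared modulus d < 1, and the
polynomial is positive on the real half-lines beyond 1 and -1. *)
Lemma schur_companionP (R : realType) (t d : R) :
  d < 1 -> 0 < 1 - t + d ->
  schur_stable (mx22 t (- d) 1 0) <-> 0 < 1 + t + d.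
Proof.
move=> d1 ht; split=> [h|ht' [a b]].
  rewrite ltNge; apply/negP => le0.
  have D0 : (t + 2) ^+ 2 <= t ^+ 2 - 4 * d by nra.
  have D1 : 0 <= t ^+ 2 - 4 * d by apply: le_trans D0; exact: sqr_ge0.
  (* (t - r) / 2 is the smaller real root, and t + 2 <= r puts it at or below -1. *)
  set r := Num.sqrt (t ^+ 2 - 4 * d).
  have r2 : r ^+ 2 = t ^+ 2 - 4 * d by rewrite sqr_sqrtr.
  have r0 : 0 <= r by exact: sqrtr_ge0.
  have tr : t + 2 <= r.
    by rewrite (le_trans (ler_norm _))// -(ler_pXn2r (n := 2))// ?nnegrE ?r2 ?real_normK ?num_real.
  have := h (((t - r) / 2) +i* 0)%C.
  rewrite eigenvalue_companion companion_complexE eq_complex /=.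
  have -> : ((t - r) / 2) ^+ 2 - 0 ^+ 2 - t * ((t - r) / 2) + d = 0.
    have -> : d = (t ^+ 2 - r ^+ 2) / 4 by rewrite r2; field.
    by field.
  rewrite !mulr0 subr0 eqxx => /(_ isT).
  rewrite normc_def ltcE /= eqxx /= expr0n /= addr0 sqrtr_sqr.
  by rewrite ltr_norml => /andP[+ _]; rewrite ltNge => /negP; apply; lra.
rewrite eigenvalue_companion companion_complexE eq_complex /=.
move=> /andP[/eqP re /eqP im].
rewrite normc_def ltcE /= eqxx /= -[ltRHS]sqrtr1 ltr_sqrt//.
have [b0|b0] := eqVneq b 0.
  move: re; rewrite b0 expr0n/= subr0 addr0 => re.
  rewrite -(real_normK (num_real a)) expr_lt1// ltr_norml.
  by apply/andP; split; nra.
(* The imaginary part gives t = 2 a, and then the real part is d = a^2 + b^2. *)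
have : t = 2 * a by apply: (mulIf b0); lra.
by move=> ta; rewrite ta in re; nra.
Qed.

(** The threshold at p controls every mode q <= p. Put h(q) = (4 - 3 q) / (2 q (1 - q)).
On (0, 2/3] the function h is decreasing, so b < h(p) gives b < h(q); and
4 - 3 q - 9 q (1 - q) = (3 q - 2)^2 shows that 9/2 is the minimum of h on
(0, 1), so b < 9/2 is enough for every q. The inequality is kept free of
division so that it also covers q = 1. *)
Lemma threshold_lower_mode (R : realType) (b p q : R) :
  0 < q -> q <= p -> p <= 1 -> b < threshold p -> 2 * (b * q) * (1 - q) < 4 - 3 * q.
Proof.
move=> q0 qp p1; rewrite /threshold; case: ifPn => [p23|_] hb.
  have p0 : 0 < p by lra.
  have pp : 0 < p * (1 - p) by nra.
  have qq : 0 < q * (1 - q) by nra.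
  have hbp : 2 * (b * p) * (1 - p) < 4 - 3 * p.
    move: hb; rewrite ltr_pdivlMr; last by nra.
    by move=> hb; lra.
  have hq : 2 * b * (p * (1 - p)) * (q * (1 - q)) < (4 - 3 * p) * (q * (1 - q)).
    by rewrite ltr_pM2r //; lra.
  have mono : (4 - 3 * p) * (q * (1 - q)) <= (4 - 3 * q) * (p * (1 - p)).
    rewrite -subr_ge0.
    have -> : (4 - 3 * q) * (p * (1 - p)) - (4 - 3 * p) * (q * (1 - q)) =
      (p - q) * (4 - 4 * (p + q) + 3 * (p * q)) by ring.
    by apply: mulr_ge0; nra.
  by rewrite -(ltr_pM2r pp); apply: lt_le_trans mono; lra.
have [->|q1] := eqVneq q 1; first by lra.
have qq : 0 < q * (1 - q) by rewrite mulr_gt0// subr_gt0 lt_neqAle q1; lra.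
have : b * (q * (1 - q)) < 9 / 2 * (q * (1 - q)) by rewrite ltr_pM2r.
have : 0 <= (3 * q - 2) ^+ 2 by exact: sqr_ge0.
lra.
Qed.

(** * Geometric decay of perturbed second order recurrences *)

(** The bound starts at k = 1 because the scheme leaves y 0 free. *)
Definition geometric_decay (R : realType) (u : nat -> R) : Prop :=
  exists C rho : R, [/\ 0 < C, 0 < rho < 1 &
    forall k, (1 <= k)%N -> `|u k| <= C * rho ^+ k].

(** The Schur-Cohn quadratic form of z^2 - t z + d for the circle of radius
sqrt p: in the pair (u, sqrt p v) it is the form for the unit circle of the
polynomial rescaled by sqrt p, multiplied by p. *)
Definition lyap (R : realType) (t d p u v : R) : R :=
  (p + d) * (u ^+ 2 + p * v ^+ 2) - 2 * t * p * u * v.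

(** Along the recurrence the form shrinks by the full factor p. Working on a
circle of radius less than 1 is what makes this a strict decrease, since the
defect is a square that vanishes on a line. *)
Lemma lyap_step (R : realType) (t d p u v : R) :
  p * lyap t d p u v - lyap t d p (t * u - d * v) u =
  (p - d) * (t * u - (p + d) * v) ^+ 2.
Proof. by rewrite /lyap; ring. Qed.

(** The form is diagonal in u + r v and u - r v, with coefficients that the
inequalities for the radius r make positive. *)
Lemma lyap_coercive (R : realType) (t d r u v : R) :
  0 <= r -> 0 < r ^+ 2 + d - t * r -> 0 < r ^+ 2 + d + t * r ->
  Num.min (r ^+ 2 + d - t * r) (r ^+ 2 + d + t * r) * (u ^+ 2 + r ^+ 2 * v ^+ 2)
    <= lyap t d (r ^+ 2) u v.
Proof.
move=> r0 h1 h2; set c := Num.min _ _.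
have c1 : c <= r ^+ 2 + d - t * r by rewrite ge_min lexx.
have c2 : c <= r ^+ 2 + d + t * r by rewrite ge_min lexx orbT.
have -> : lyap t d (r ^+ 2) u v =
  (r ^+ 2 + d - t * r) / 2 * (u + r * v) ^+ 2
  + (r ^+ 2 + d + t * r) / 2 * (u - r * v) ^+ 2 by rewrite /lyap; field.
have -> : c * (u ^+ 2 + r ^+ 2 * v ^+ 2) =
  c / 2 * (u + r * v) ^+ 2 + c / 2 * (u - r * v) ^+ 2 by field.
by apply: lerD; apply: ler_wpM2r; rewrite ?sqr_ge0// ler_pM2r// invr_gt0.
Qed.

(** A perturbation of size e of the coefficients changes the form by O(e); the
constant 28 is 2 * 14, where 14 comes from the crude bounds below and 2 from
(|u| + |v|)^2 <= 2 (u^2 + v^2). *)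
Lemma lyap_perturb (R : realType) (t d p u v x y e : R) :
  `|t| <= 2 -> `|d| <= 1 -> 0 <= p <= 1 -> 0 <= e <= 1 ->
  `|x| <= e -> `|y| <= e ->
  lyap t d p ((t + x) * u + (- d + y) * v) u <=
  lyap t d p (t * u - d * v) u + 28 * e * (u ^+ 2 + v ^+ 2).
Proof.
move=> ht hd /andP[p0 p1] /andP[e0 e1] hx hy.
set S := `|u| + `|v|.
have S0 : 0 <= S by rewrite addr_ge0.
have uS : `|u| <= S by rewrite lerDl.
have S2 : S ^+ 2 <= 2 * (u ^+ 2 + v ^+ 2).
  rewrite -(real_normK (num_real u)) -(real_normK (num_real v)) -subr_ge0.
  by rewrite [leRHS](_ : _ = (`|u| - `|v|) ^+ 2) ?sqr_ge0// /S; ring.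
set h := t * u - d * v.
have hS : `|h| <= 2 * S.
  rewrite (le_trans (ler_normB _ _))// !normrM /S mulrDr lerD ?ler_wpM2r//.
  by apply: le_trans hd _; lra.
set r := x * u + y * v.
have rS : `|r| <= e * S.
  by rewrite (le_trans (ler_normD _ _))// !normrM /S mulrDr lerD ?ler_wpM2r//.
have -> : (t + x) * u + (- d + y) * v = h + r by rewrite /h /r; ring.
have -> : lyap t d p (h + r) u =
  lyap t d p h u + r * ((p + d) * (2 * h + r) - 2 * t * p * u).
  by rewrite /lyap; ring.
rewrite lerD2l.
have pd : `|p + d| <= 2.
  rewrite (le_trans (ler_normD _ _))// (ger0_norm p0); lra.
have b1 : `|2 * h + r| <= 5 * S.
  rewrite (le_trans (ler_normD _ _))// normrM gtr0_norm//.
  have : e * S <= S by rewrite ler_piMl.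
  lra.
have b2 : `|2 * t * p * u| <= 4 * S.
  rewrite !normrM gtr0_norm// (ger0_norm p0).
  apply: ler_pM => //; first by rewrite !mulr_ge0.
  have : `|t| * p <= 2 * 1 by apply: ler_pM.
  lra.
have b3 : `|(p + d) * (2 * h + r) - 2 * t * p * u| <= 14 * S.
  rewrite (le_trans (ler_normB _ _))// normrM.
  have : `|p + d| * `|2 * h + r| <= 2 * (5 * S) by apply: ler_pM.
  lra.
apply: (le_trans (ler_norm _)); rewrite normrM.
apply: (@le_trans _ _ (e * S * (14 * S))); first by apply: ler_pM.
have : e * S ^+ 2 <= e * (2 * (u ^+ 2 + v ^+ 2)) by apply: ler_wpM2l.
lra.
Qed.

Lemma geometric_growth (R : realType) (p : R) (w : nat -> R) (N : nat) :
  0 <= p -> (forall k, (N <= k)%N -> w k.+1 <= p * w k) ->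
  forall k, w (N + k)%N <= p ^+ k * w N.
Proof.
move=> p0 hw; elim=> [|k IH]; first by rewrite addn0 expr0 mul1r.
rewrite addnS (le_trans (hw _ (leq_addr _ _)))// exprS -mulrA.
exact: ler_wpM2l.
Qed.

Lemma geometric_decay_near (R : realType) (u : nat -> R) (C rho : R) (N : nat) :
  0 < rho < 1 -> (forall k, `|u (N + k)%N| <= C * rho ^+ k) ->
  geometric_decay u.
Proof.
move=> /andP[r0 r1] hu.
pose M := \sum_(i < N) `|u i| / rho ^+ i + `|C| / rho ^+ N + 1.
have sumge0 : 0 <= \sum_(i < N) `|u i| / rho ^+ i.
  by apply: sumr_ge0 => i _; rewrite divr_ge0// exprn_ge0// ltW.
have C0 : 0 <= `|C| / rho ^+ N by rewrite divr_ge0// exprn_ge0// ltW.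
exists M, rho; split; [by rewrite /M; lra|by rewrite r0|move=> k _].
have rk : 0 < rho ^+ k by exact: exprn_gt0.
rewrite -ler_pdivrMr//.
have [kN|Nk] := ltnP k N.
  have : `|u k| / rho ^+ k <= \sum_(i < N) `|u i| / rho ^+ i.
    rewrite (bigD1 (Ordinal kN))//= lerDl; apply: sumr_ge0 => i _.
    by rewrite divr_ge0// exprn_ge0// ltW.
  by rewrite /M; lra.
have : `|u k| / rho ^+ k <= `|C| / rho ^+ N.
  rewrite ler_pdivrMr// -(subnKC Nk) exprD mulrA divfK; last first.
    by rewrite gt_eqF// exprn_gt0.
  apply: le_trans (hu _) _; apply: ler_wpM2r; first by rewrite exprn_ge0// ltW.
  exact: ler_norm.
by rewrite /M; lra.
Qed.

(** A Poincare-type statement: a second order recurrence whose coefficients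
converge to those of a Schur stable one decays geometrically. The form of a
slightly smaller circle contracts by p < 1 along the limit recurrence, and the
perturbation eventually costs at most half of the gap 1 - p. *)
Lemma perturbed_recurrence_decay (R : realType) (t d : R) (a b u : nat -> R) :
  d < 1 -> 0 < 1 - t + d -> 0 < 1 + t + d ->
  a k @[k --> \oo] --> t -> b k @[k --> \oo] --> - d ->
  (forall k, (1 <= k)%N -> u k.+1 = a k * u k + b k * u k.-1) ->
  geometric_decay u.
Proof.
move=> d1 h1 h2 at_ bd hu.
(* The strict inequalities are open, so they survive on a circle of radius
   r < 1: each has slack at least m, and r = 1 - m / 8 uses less than that. *)
have [r [r0 r1 [r2 r3 r4]]] : exists r : R, [/\ 0 < r, r < 1 &
    [/\ d < r ^+ 2, 0 < r ^+ 2 + d - t * r & 0 < r ^+ 2 + d + t * r]].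
  pose m := Num.min (1 - d) (Num.min (1 - t + d) (1 + t + d)).
  have m1 : m <= 1 - d by rewrite ge_min lexx.
  have m2 : m <= 1 - t + d by rewrite !ge_min lexx orbT.
  have m3 : m <= 1 + t + d by rewrite !ge_min lexx !orbT.
  have m0 : 0 < m by rewrite !lt_min h1 h2 subr_gt0 d1.
  exists (1 - m / 8); split; [lra|lra|].
  by split; nra.
pose p := r ^+ 2.
have p0 : 0 < p by rewrite exprn_gt0.
have p1 : p < 1 by rewrite expr_lt1// ltW.
pose c := Num.min (r ^+ 2 + d - t * r) (r ^+ 2 + d + t * r) * p.
have c0 : 0 < c by rewrite mulr_gt0// lt_min r3.
have coerc x y : c * (x ^+ 2 + y ^+ 2) <= lyap t d p x y.
  apply: le_trans (lyap_coercive _ _ (ltW r0) r3 r4).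
  rewrite /c -mulrA ler_wpM2l//; first by rewrite le_min !ltW.
  by rewrite mulrDr lerD2r// ler_piMl// ?sqr_ge0// ltW.
have sq0 (x y : R) : 0 <= x ^+ 2 + y ^+ 2 by rewrite addr_ge0// sqr_ge0.
pose s := (1 + p) / 2.
have s0 : 0 < s by rewrite /s; lra.
have s1 : s < 1 by rewrite /s; lra.
pose e := Num.min 1 (c * (1 - p) / 56).
have e0 : 0 < e.
  by rewrite lt_min ltr01 /= divr_gt0// mulr_gt0// subr_gt0.
have e1 : e <= 1 by rewrite ge_min lexx.
have e2 : 28 * e <= c * ((1 - p) / 2).
  have : e <= c * (1 - p) / 56 by rewrite ge_min lexx orbT.
  lra.
have [N hN] : exists N, forall k, (N <= k)%N -> `|a k - t| <= e /\ `|b k + d| <= e.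
  have ha : \forall k \near \oo, `|t - a k| <= e.
    by move/cvgrPdist_le : at_ => /(_ _ e0).
  have hb : \forall k \near \oo, `|- d - b k| <= e.
    by move/cvgrPdist_le : bd => /(_ _ e0).
  have [N _ hN] := filterI ha hb.
  exists N => k Nk; have [h h'] := hN k Nk; split; first by rewrite distrC.
  by move: h'; rewrite distrC opprK.
pose w k := lyap t d p (u k.+1) (u k).
have wstep k : (N <= k)%N -> w k.+1 <= s * w k.
  move=> Nk; have [ha hb] := hN k.+1 (leqW Nk).
  rewrite /w hu//=.
  have -> : a k.+1 * u k.+1 + b k.+1 * u k =
    (t + (a k.+1 - t)) * u k.+1 + (- d + (b k.+1 + d)) * u k by ring.
  apply: (le_trans (@lyap_perturb _ _ _ _ _ _ _ _ e _ _ _ _ ha hb)).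
  - by rewrite ler_norml; apply/andP; split; lra.
  - by rewrite ler_norml; apply/andP; split; lra.
  - by rewrite !ltW.
  - by rewrite e1 ltW.
  have := lyap_step t d p (u k.+1) (u k); rewrite -/(w k).
  have : 0 <= (p - d) * (t * u k.+1 - (p + d) * u k) ^+ 2.
    by rewrite mulr_ge0 ?sqr_ge0// subr_ge0 ltW.
  have := coerc (u k.+1) (u k); rewrite -/(w k) => hc.
  have : 28 * e * (u k.+1 ^+ 2 + u k ^+ 2) <=
         c * ((1 - p) / 2) * (u k.+1 ^+ 2 + u k ^+ 2) by rewrite ler_wpM2r.
  have : (1 - p) / 2 * (c * (u k.+1 ^+ 2 + u k ^+ 2)) <= (1 - p) / 2 * w k.
    by rewrite ler_wpM2l// divr_ge0// subr_ge0 ltW.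
  rewrite /s; lra.
have wdecay := geometric_growth (ltW s0) wstep.
have wN0 : 0 <= w N by apply: le_trans (coerc _ _); rewrite mulr_ge0// ltW.
apply: (@geometric_decay_near _ _ (Num.sqrt (w N / c)) (Num.sqrt s) N).
  by rewrite sqrtr_gt0 s0 /= -[ltRHS]sqrtr1 ltr_sqrt.
move=> k.
have s2 : s ^+ k = (Num.sqrt s ^+ k) ^+ 2.
  by rewrite -exprM mulnC exprM sqr_sqrtr// ltW.
rewrite -(ler_pXn2r (n := 2))// ?nnegrE ?mulr_ge0 ?exprn_ge0 ?sqrtr_ge0//.
rewrite exprMn -s2 sqr_sqrtr; last by rewrite divr_ge0// ltW.
rewrite real_normK ?num_real// mulrAC ler_pdivlMr// mulrC [leRHS]mulrC.
apply: le_trans (wdecay k); apply: le_trans (coerc _ _).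
by rewrite ler_pM2l// lerDr sqr_ge0.
Qed.

(** * Symmetric matrices, the Euclidean norm and quadratic functions *)

Lemma map_complex_real (R : realType) m n (A : 'M[complex R]_(m, n)) :
  A \is a mxOver Num.real -> exists B : 'M[R]_(m, n), A = map_mx (real_complex R) B.
Proof.
move=> /mxOverP hA; exists (map_mx (@complex.Re R) A).
by apply/matrixP => i j; rewrite !mxE RRe_real.
Qed.

Lemma real_complex_mxOver (R : realType) m n (B : 'M[R]_(m, n)) :
  map_mx (real_complex R) B \is a mxOver Num.real.
Proof. by apply/mxOverP => i j; rewrite !mxE complex_real. Qed.

(** Over the complex numbers Q is Hermitian, hence unitarily similar to a real
diagonal matrix; real matrices that are similar over the complex numbers are
similar over the reals. The matrix P need not be orthogonal, which is enough
to bound norms up to constants. *)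
Lemma symmetric_diagonalizable (R : realType) (n : nat) (Q : 'M[R]_n) :
  Q^T = Q -> exists P : 'M[R]_n, exists2 d : 'rV[R]_n,
    P \in unitmx & P *m Q = diag_mx d *m P.
Proof.
move=> symQ; pose A := map_mx (real_complex R) Q.
have Areal : A \is a mxOver Num.real by exact: real_complex_mxOver.
have Aherm : A \is hermsymmx.
  apply: realsym_hermsym => //; apply/is_hermitianmxP.
  by rewrite expr0 scale1r map_mx_id// /A map_trmx symQ.
have [d hd] := map_complex_real (hermitian_spectral_diag_real Aherm).
have sA : similar_in unitmx A (map_mx (real_complex R) (diag_mx d)).
  exists (spectralmx A); first exact: spectral_unit.
  apply/similarP; first exact: spectral_unit.
  have /hermitian_normalmx/orthomx_spectralP {2}-> := Aherm.
  by rewrite !mulmxA mulmxV ?spectral_unit// mul1mx hd map_diag_mx.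
have [P'] := real_similar sA Areal (real_complex_mxOver _).
rewrite inE => /andP[/map_complex_real[P ->]]; rewrite map_unitmx => uP.
move=> /similarP; rewrite map_unitmx => /(_ uP).
by rewrite -!map_mxM => /map_mx_inj h; exists P, d.
Qed.

Lemma dotvE (R : realType) n (u v : 'cV[R]_n) : dotv u v = (u^T *m v) 0 0.
Proof. by rewrite mxE; apply: eq_bigr => i _; rewrite mxE. Qed.

Lemma dotvC (R : realType) n (u v : 'cV[R]_n) : dotv u v = dotv v u.
Proof. by apply: eq_bigr => i _; rewrite mulrC. Qed.

Lemma dotv_ge0 (R : realType) n (u : 'cV[R]_n) : 0 <= dotv u u.
Proof. by apply: sumr_ge0 => i _; rewrite -expr2 sqr_ge0. Qed.

Lemma dotvDl (R : realType) n (u v w : 'cV[R]_n) :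
  dotv (u + v) w = dotv u w + dotv v w.
Proof. by rewrite -big_split; apply: eq_bigr => i _; rewrite mxE mulrDl. Qed.

Lemma dotvZl (R : realType) n (a : R) (u v : 'cV[R]_n) :
  dotv (a *: u) v = a * dotv u v.
Proof. by rewrite mulr_sumr; apply: eq_bigr => i _; rewrite mxE mulrA. Qed.

Lemma dotvDr (R : realType) n (u v w : 'cV[R]_n) :
  dotv w (u + v) = dotv w u + dotv w v.
Proof. by rewrite dotvC dotvDl !(dotvC w). Qed.

Lemma dotvZr (R : realType) n (a : R) (u v : 'cV[R]_n) :
  dotv u (a *: v) = a * dotv u v.
Proof. by rewrite dotvC dotvZl dotvC. Qed.

Lemma dotv_sym (R : realType) n (Q : 'M[R]_n) (u v : 'cV[R]_n) :
  Q^T = Q -> dotv (Q *m u) v = dotv u (Q *m v).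
Proof. by move=> symQ; rewrite !dotvE trmx_mul symQ mulmxA. Qed.

Lemma enorm_ge0 (R : realType) n (u : 'cV[R]_n) : 0 <= enorm u.
Proof. exact: sqrtr_ge0. Qed.

Lemma enormZ (R : realType) n (a : R) (u : 'cV[R]_n) :
  enorm (a *: u) = `|a| * enorm u.
Proof.
by rewrite /enorm dotvZl dotvZr mulrA -expr2 sqrtrM ?sqr_ge0// sqrtr_sqr.
Qed.

Lemma enorm_eq0 (R : realType) n (u : 'cV[R]_n) : enorm u = 0 -> u = 0.
Proof.
move=> /eqP; rewrite sqrtr_eq0 => le0.
have /eqP : dotv u u = 0 by apply/eqP; rewrite eq_le le0 dotv_ge0.
rewrite psumr_eq0; last by move=> i _; rewrite -expr2 sqr_ge0.
move=> /allP h; apply/colP => i; rewrite mxE; apply/eqP.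
by have := h i (mem_index_enum _); rewrite mulf_eq0 orbb.
Qed.

Lemma entry_le_enorm (R : realType) n (u : 'cV[R]_n) i : `|u i 0| <= enorm u.
Proof.
rewrite -sqrtr_sqr ler_sqrt ?dotv_ge0// /dotv (bigD1 i)//= -expr2 lerDl.
by apply: sumr_ge0 => j _; rewrite -expr2 sqr_ge0.
Qed.

Lemma enorm_le_sum (R : realType) n (u : 'cV[R]_n) :
  enorm u <= \sum_(i < n) `|u i 0|.
Proof.
have s0 : 0 <= \sum_(i < n) `|u i 0| by exact: sumr_ge0.
rewrite -(ger0_norm s0) -sqrtr_sqr ler_sqrt ?sqr_ge0// expr2 mulr_suml.
apply: ler_sum => i _; rewrite -expr2 -(real_normK (num_real _)) expr2.
rewrite ler_wpM2l// (bigD1 i)//= lerDl; exact: sumr_ge0.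
Qed.

(** Makes the supremum in the operator norm a genuine one, and transfers decay
between coordinate systems. *)
Lemma enorm_mulmx_bounded (R : realType) n (A : 'M[R]_n) :
  exists2 M : R, 0 <= M & forall v, enorm (A *m v) <= M * enorm v.
Proof.
exists (\sum_(i < n) \sum_(j < n) `|A i j|).
  by apply: sumr_ge0 => i _; exact: sumr_ge0.
move=> v; apply: (le_trans (enorm_le_sum _)).
rewrite mulr_suml; apply: ler_sum => i _; rewrite mxE mulr_suml.
apply: (le_trans (ler_norm_sum _ _ _)); apply: ler_sum => j _.
by rewrite normrM ler_wpM2l// entry_le_enorm.
Qed.

Lemma enorm_mulmx_le_opnorm (R : realType) n (Q : 'M[R]_n) (v : 'cV[R]_n) :
  enorm (Q *m v) <= opnorm Q * enorm v.
Proof.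
(* By homogeneity it suffices to normalize v, except when it vanishes. *)
have [v0|v0] := eqVneq (enorm v) 0.
  by rewrite v0 (enorm_eq0 v0) mulmx0 mulr0 /enorm /dotv big1 ?sqrtr0// => i _;
    rewrite mxE mul0r.
have vp : 0 < enorm v by rewrite lt_neqAle eq_sym v0 enorm_ge0.
rewrite -ler_pdivrMr// mulrC -{1}(gtr0_norm (x := (enorm v)^-1)) ?invr_gt0//.
rewrite -enormZ scalemxAr; apply: ub_le_sup; last first.
  exists ((enorm v)^-1 *: v) => //=.
  by rewrite enormZ gtr0_norm ?invr_gt0// mulVf.
have [M M0 hM] := enorm_mulmx_bounded Q.
exists M => _ [w /= w1 <-]; apply: le_trans (hM w) _.
by rewrite ler_piMr.
Qed.

Lemma opnorm_scalar_le (R : realType) n (a : R) :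
  0 <= a -> opnorm (a%:M : 'M[R]_n) <= a.
Proof.
move=> a0; apply: ge_sup.
  exists (enorm (a%:M *m (0 : 'cV[R]_n))), 0 => //=.
  by rewrite /enorm /dotv big1 ?sqrtr0// => i _; rewrite mxE mul0r.
move=> _ [v /= v1 <-]; rewrite mul_scalar_mx enormZ ger0_norm//.
by rewrite ler_piMr.
Qed.

Lemma sym_eigenvector (R : realType) n (Q : 'M[R]_n) (lam : R) :
  Q^T = Q -> eigenvalue Q lam ->
  exists2 v : 'cV[R]_n, 0 < enorm v & Q *m v = lam *: v.
Proof.
move=> symQ /eigenvalueP[w wQ w0]; exists w^T.
  rewrite lt_neqAle enorm_ge0 andbT eq_sym; apply: contra w0 => /eqP/enorm_eq0 h.
  by rewrite -[w]trmxK h trmx0.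
by rewrite -{1}symQ -trmx_mul wQ linearZ.
Qed.

Lemma eigenvalue_le_opnorm (R : realType) n (Q : 'M[R]_n) (lam : R) :
  Q^T = Q -> eigenvalue Q lam -> lam <= opnorm Q.
Proof.
move=> symQ /(sym_eigenvector symQ)[v v0 Qv].
have := enorm_mulmx_le_opnorm Q v; rewrite Qv enormZ ler_pM2r//.
exact: le_trans (ler_norm _).
Qed.

Lemma psd_eigenvalue_ge0 (R : realType) n (Q : 'M[R]_n) (lam : R) :
  Q^T = Q -> psdmx Q -> eigenvalue Q lam -> 0 <= lam.
Proof.
move=> symQ psdQ /(sym_eigenvector symQ)[v v0 Qv].
have := psdQ v; rewrite Qv dotvZl pmulr_lge0//.
by move: v0; rewrite sqrtr_gt0.
Qed.

Lemma quad_expand (R : realType) n (Q : 'M[R]_n) (e z : 'cV[R]_n) (h : R) :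
  Q^T = Q -> dotv (Q *m (h *: e + z)) (h *: e + z) =
    dotv (Q *m z) z + 2 * h * dotv (Q *m z) e + h ^+ 2 * dotv (Q *m e) e.
Proof.
move=> symQ; rewrite mulmxDr -scalemxAr !dotvDl !dotvDr !dotvZl !dotvZr.
by rewrite (dotv_sym e z symQ) (dotvC e); ring.
Qed.

(** Along a coordinate direction e the difference quotient is exactly the i-th
entry of Q (x - xstar) plus a multiple of h. *)
Lemma grad_quadf (R : realType) n (Q : 'M[R]_n) (xstar : 'cV[R]_n) (fstar : R)
    (x : 'cV[R]_n) :
  Q^T = Q -> grad (quadf Q xstar fstar) x = Q *m (x - xstar).
Proof.
move=> symQ; apply/colP => i; rewrite mxE /derive.
set z := x - xstar; set e := delta_mx i 0.
have eE : dotv (Q *m z) e = (Q *m z) i 0.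
  rewrite /dotv (bigD1 i)//= big1 ?addr0.
    by rewrite [e _ _]mxE !eqxx mulr1.
  by move=> j ji; rewrite [e _ _]mxE (negbTE ji) mulr0.
apply: cvg_lim => //.
have h0 : (fun h : R => (Q *m z) i 0 + h * (1 / 2 * dotv (Q *m e) e)) @ 0^'
   --> (Q *m z) i 0.
  rewrite -[X in _ --> X]addr0; apply: cvgD; first exact: cvg_cst.
  rewrite -[X in _ --> X](mul0r (1 / 2 * dotv (Q *m e) e)).
  by apply: cvgM; [exact: (cvg_within (F := nbhs 0))|exact: cvg_cst].
apply: cvg_trans h0; apply: near_eq_cvg; near=> h.
have hn0 : h != 0 by near: h; exact: nbhs_dnbhs_neq.
rewrite /quadf /shift /= -[h *: e + x - xstar]addrA -/z.
rewrite quad_expand// eE /GRing.scale /=.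
by field.
Unshelve. all: by end_near. Qed.

(** With a generalized inverse G, so that Q = Q G Q, symmetry turns <Q z, z> into
<G Q z, Q z>. The components of z in the kernel of Q thus disappear, and the
function gap inherits twice the decay rate of the gradient. *)
Lemma quad_le_grad (R : realType) n (Q : 'M[R]_n) :
  Q^T = Q -> exists2 M : R, 0 <= M &
    forall z : 'cV[R]_n, dotv (Q *m z) z <= M * enorm (Q *m z) ^+ 2.
Proof.
move=> symQ; have [M M0 hM] := enorm_mulmx_bounded (pinvmx Q).
exists (n%:R * M); first by rewrite mulr_ge0.
move=> z; set g := Q *m z.
have -> : dotv g z = dotv (pinvmx Q *m g) g.
  have {1}-> : g = Q *m (pinvmx Q *m g).
    by rewrite /g -{1}(mulmxKpV (submx_refl Q)) -!(mulmxA _ _ Q) -!mulmxA.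
  by rewrite dotv_sym.
apply: (@le_trans _ _ (\sum_(i < n) M * enorm g ^+ 2)); last first.
  by rewrite sumr_const card_ord -mulrA mulr_natl.
apply: ler_sum => i _; apply: le_trans (ler_norm _) _.
rewrite normrM expr2 mulrA; apply: ler_pM => //; last exact: entry_le_enorm.
exact: le_trans (entry_le_enorm _ _) (hM _).
Qed.

(** * Asymptotics of a single mode *)

Lemma cvg_div_nat (R : realType) (c : R) : c / k%:R @[k --> \oo] --> (0 : R).
Proof.
rewrite -[X in _ --> X](mulr0 c); apply: cvgM; first exact: cvg_cst.
by apply/gtr0_cvgV0; [exists 1%N => // k /= k1; rewrite ltr0n|exact: cvgr_idn].
Qed.

Lemma geometric_decay_le (R : realType) (u v : nat -> R) (M : R) :
  (forall k, (1 <= k)%N -> `|v k| <= M * `|u k|) ->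
  geometric_decay u -> geometric_decay v.
Proof.
move=> huv [C [rho [C0 r01 hu]]].
exists ((`|M| + 1) * C), rho; split=> //; first by rewrite mulr_gt0// ltr_wpDl.
move=> k k1; rewrite -mulrA (le_trans (huv k k1))//.
apply: (@le_trans _ _ ((`|M| + 1) * `|u k|)).
  by rewrite ler_wpM2r// (le_trans (ler_norm M))// lerDl.
by rewrite ler_wpM2l ?hu// addr_ge0.
Qed.

Lemma geometric_decay_of_shift (R : realType) (u : nat -> R) :
  geometric_decay (fun k => u k.+1) -> geometric_decay u.
Proof.
move=> [C [rho [C0 /andP[r0 r1] hu]]].
apply: (@geometric_decay_near _ _ (C * rho) rho 2); first by rewrite r0.
by move=> k; rewrite -mulrA -exprS add2n; exact: hu.
Qed.

Lemma geometric_decayD (R : realType) (u v : nat -> R) :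
  geometric_decay u -> geometric_decay v ->
  geometric_decay (fun k => u k + v k).
Proof.
move=> [C [r [C0 /andP[r0 r1] hu]]] [D [t [D0 /andP[t0 t1] hv]]].
exists (C + D), (Num.max r t); split; first exact: addr_gt0.
  by rewrite lt_max r0 gt_max r1.
move=> k k1; rewrite (le_trans (ler_normD _ _))// mulrDl.
apply: lerD; [apply: le_trans (hu k k1) _|apply: le_trans (hv k k1) _].
  by rewrite ler_pM2l// lerXn2r ?nnegrE ?le_max ?lexx ?(ltW r0).
by rewrite ler_pM2l// lerXn2r ?nnegrE ?le_max ?lexx ?(ltW r0) ?(ltW t0) ?orbT.
Qed.

Lemma geometric_decay_sum (R : realType) n (u : 'I_n -> nat -> R) :
  (forall i, geometric_decay (u i)) ->
  geometric_decay (fun k => \sum_(i < n) `|u i k|).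
Proof.
move=> hu; elim: n u hu => [|n IH] u hu.
  exists 1, (1 / 2); split => //; first by apply/andP; split; lra.
  by move=> k _; rewrite big_ord0 normr0 mul1r exprn_ge0// divr_ge0.
have : geometric_decay (fun k => `|u ord0 k| + \sum_(i < n) `|u (lift ord0 i) k|).
  apply: geometric_decayD; last by apply: IH => i; exact: hu.
  by apply: geometric_decay_le (hu ord0) => k _; rewrite normr_id -[leLHS]mul1r.
by apply: (@geometric_decay_le _ _ _ 1) => k _; rewrite big_ord_recl mul1r.
Qed.

Lemma geometric_decay_cvg0 (R : realType) (u : nat -> R) :
  geometric_decay u -> u k @[k --> \oo] --> 0.
Proof.
move=> [C [rho [C0 /andP[r0 r1] hu]]].
have h : geometric C rho @ \oo --> (0 : R).
  by apply: cvg_geometric; rewrite ger0_norm// ltW.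
apply/cvgr0Pnorm_lt => e e0; near=> k.
apply: (@le_lt_trans _ _ (geometric C rho k)); first by apply: hu; near: k; exists 1%N.
rewrite (le_lt_trans (ler_norm _))//; near: k.
by move/cvgr0Pnorm_lt : h; apply.
Unshelve. all: by end_near. Qed.

(** The scheme seen along an eigenvector with eigenvalue lam: xi and eta are the
coordinates of x - xstar and y - xstar. *)
Definition mode_scheme (R : realType) (alpha beta s lam : R) (xi eta : nat -> R) :=
  forall k, (1 <= k)%N ->
    eta k = xi k + (1 - alpha / k%:R) * (xi k - xi k.-1)
      - beta * Num.sqrt s * (lam * xi k - lam * xi k.-1)
      - beta * Num.sqrt s / k%:R * (lam * xi k.-1)
    /\ xi k.+1 = eta k - s * (lam * eta k).

(** Eliminating eta gives a recurrence for xi whose coefficients converge to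
those of the limiting matrix; eta is a bounded combination of two consecutive
values of xi. Bounding eta this way, and not as xi k.+1 / (1 - q), covers
the case q = 1. *)
Lemma positive_mode_decay (R : realType) (alpha beta s lam : R) (xi eta : nat -> R) :
  0 <= beta -> 0 < s -> 0 < lam -> s * lam <= 1 ->
  2 * (beta * lam * Num.sqrt s) * (1 - s * lam) < 4 - 3 * (s * lam) ->
  mode_scheme alpha beta s lam xi eta ->
  geometric_decay xi /\ geometric_decay eta.
Proof.
move=> b0 s0 l0; set q := s * lam; set d := beta * lam * Num.sqrt s.
move=> q1 hd hrec.
have q0 : 0 < q by rewrite mulr_gt0.
have d0 : 0 <= d by rewrite !mulr_ge0// ?sqrtr_ge0// ltW.
have etaE k : (1 <= k)%N -> eta k = (2 - d - alpha / k%:R) * xi k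
    + (- (1 - d) + (alpha - d) / k%:R) * xi k.-1.
  move=> k1; have [-> _] := hrec k k1; rewrite /d; ring.
have xidec : geometric_decay xi.
  apply: (@perturbed_recurrence_decay _ ((1 - q) * (2 - d)) ((1 - q) * (1 - d))
    (fun k => (1 - q) * (2 - d - alpha / k%:R))
    (fun k => (1 - q) * (- (1 - d) + (alpha - d) / k%:R))).
  (* With t = (1 - q) (2 - d) and D = (1 - q) (1 - d) one has 1 - t + D = q, and
     1 + t + D = 4 - 3 q - 2 d (1 - q). *)
  - nra.
  - lra.
  - lra.
  - apply: cvgM; first exact: cvg_cst.
    rewrite -[X in _ --> X](subr0 (2 - d)).
    by apply: cvgB; [exact: cvg_cst|exact: cvg_div_nat].
  - rewrite -(mulrN (1 - q)); apply: cvgM; first exact: cvg_cst.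
    rewrite -[X in _ --> X](addr0 (- (1 - d))).
    by apply: cvgD; [exact: cvg_cst|exact: cvg_div_nat].
  - move=> k k1; have [_ ->] := hrec k k1; rewrite etaE// /q; ring.
split=> //; apply: geometric_decay_of_shift.
have xidec' : geometric_decay (fun k => xi k.+1).
  have [C [rho [C0 /andP[r0 r1] hxi]]] := xidec.
  exists (C * rho), rho; split; [exact: mulr_gt0|by rewrite r0|].
  by move=> k k1; rewrite -mulrA -exprS; exact: hxi.
pose M := 2 + 2 * d + `|alpha|.
have : geometric_decay (fun k => `|xi k.+1| + `|xi k|).
  apply: geometric_decayD.
    by apply: geometric_decay_le xidec' => k _; rewrite normr_id -[leLHS]mul1r.
  by apply: geometric_decay_le xidec => k _; rewrite normr_id -[leLHS]mul1r.
apply: (@geometric_decay_le _ _ _ M) => k _; rewrite etaE//=.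
have inv1 : 0 <= (k.+1%:R : R)^-1 <= 1.
  by rewrite invr_ge0 ler0n /= invf_le1// ?ltr0n// ler1n.
have ak : `|alpha / k.+1%:R| <= `|alpha|.
  by case/andP: inv1 => i0 i1; rewrite normrM (ger0_norm i0) ler_piMr.
have dk : `|d / k.+1%:R| <= d.
  by case/andP: inv1 => i0 i1; rewrite normrM (ger0_norm i0) (ger0_norm d0) ler_piMr.
rewrite [leRHS](_ : _ = M * `|xi k.+1| + M * `|xi k|); last first.
  by rewrite ger0_norm ?mulrDr// addr_ge0.
rewrite (le_trans (ler_normD _ _))// !normrM; apply: lerD; apply: ler_wpM2r => //.
  rewrite /M; move: (alpha / _) ak => a; rewrite !ler_norml => /andP[? ?].
  by apply/andP; split; lra.
rewrite /M mulrBl; move: (alpha / _) (d / _) ak dk => a b.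
rewrite !ler_norml => /andP[? ?] /andP[? ?].
by apply/andP; split; lra.
Qed.

(** The increments D k = xi k.+1 - xi k satisfy (k + 1) D k.+1 = (k + 1 - alpha) D k,
so k D k + (alpha - 1) xi k is constant in k, equal to (alpha - 1) xi 0. As
alpha >= 3, the quantity k^2 |D k| is eventually nonincreasing, hence k D k
tends to 0 and xi returns to its initial value. *)
Lemma kernel_mode_cvg (R : realType) (alpha beta s : R) (xi eta : nat -> R) :
  3 <= alpha -> mode_scheme alpha beta s 0 xi eta ->
  xi k @[k --> \oo] --> xi 0%N.
Proof.
move=> ha hrec; pose D k := xi k.+1 - xi k.
have DS k : k.+1%:R * D k.+1 = (k.+1%:R - alpha) * D k.
  have [e1 e2] := hrec k.+1 isT; rewrite /D e2 e1 /=; field.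
  by apply: lt0r_neq0; have := ler0n R k; lra.
have inv k : k%:R * D k = (alpha - 1) * (xi 0%N - xi k).
  elim: k => [|k IH]; first by rewrite mul0r subrr mulr0.
  rewrite DS -[k.+1%:R](_ : k%:R + 1 = _); last by rewrite -natr1.
  rewrite (_ : k%:R + 1 - alpha = k%:R + (1 - alpha)); last by ring.
  by rewrite mulrDl IH /D; ring.
have [N hN] : exists N : nat, alpha <= N%:R.
  exists (Num.bound alpha); by apply/ltW/archi_boundP; lra.
pose B := N%:R ^+ 2 * `|D N|.
have bnd k : (N + k)%:R ^+ 2 * `|D (N + k)%N| <= B.
  elim: k => [|k IH]; first by rewrite addn0.
  apply: le_trans IH; rewrite addnS; set m := (N + k)%N.
  have mN : alpha <= m%:R by apply: (le_trans hN); rewrite ler_nat leq_addr.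
  have m0 : 0 <= m.+1%:R :> R by [].
  rewrite expr2 -mulrA -{2}(ger0_norm m0) -normrM DS normrM.
  rewrite mulrA; apply: ler_wpM2r => //.
  rewrite ger0_norm; last by rewrite -natr1; lra.
  (* (m + 1) (m + 1 - alpha) <= m ^ 2, since alpha >= 3. *)
  by rewrite -natr1; nra.
have kD0 : k%:R * D k @[k --> \oo] --> (0 : R).
  apply/cvgr0Pnorm_le => e e0.
  have := cvg_div_nat B => /cvgr0Pnorm_le /(_ e e0) hB.
  near=> k.
  have k0 : (0 < k)%N by near: k; exists 1%N.
  have kN : (N <= k)%N by near: k; exists N.
  apply: (@le_trans _ _ `|B / k%:R|); last by near: k.
  apply: le_trans (ler_norm _); rewrite normrM (ger0_norm (ler0n _ _)).
  rewrite ler_pdivlMr ?ltr0n// mulrC mulrA -expr2.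
  by rewrite -(subnKC kN); exact: bnd.
have lim0 : xi 0%N - (alpha - 1)^-1 * (k%:R * D k) @[k --> \oo] --> xi 0%N.
  rewrite -[X in _ --> X](subr0 (xi 0%N)); apply: cvgB; first exact: cvg_cst.
  rewrite -[X in _ --> X](mulr0 (alpha - 1)^-1).
  by apply: cvgM; [exact: cvg_cst|exact: kD0].
apply: cvg_trans lim0; apply: near_eq_cvg; near=> k.
by rewrite inv; field; apply: lt0r_neq0; lra.
Unshelve. all: by end_near. Qed.

(** * Polynomial rates from geometric decay *)

Lemma natmul_geometric_bounded (R : realType) (rho : R) : 0 < rho < 1 ->
  exists2 B : R, 0 < B & forall k : nat, k%:R * rho ^+ k <= B.
Proof.
move=> /andP[r0 r1]; have ir0 : 0 < 1 - rho by rewrite subr_gt0.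
exists (1 - rho)^-1; first by rewrite invr_gt0.
move=> k; rewrite -[leRHS]mul1r ler_pdivlMr//.
(* The sharper claim k rho^k (1 - rho) <= 1 - rho^k can be proved by induction. *)
have key : forall k : nat, k%:R * rho ^+ k * (1 - rho) <= 1 - rho ^+ k.
  elim=> [|m IH]; first by rewrite mul0r expr0 subrr mul0r.
  have : rho * (m%:R * rho ^+ m * (1 - rho)) <= rho * (1 - rho ^+ m).
    by rewrite ler_wpM2l// ltW.
  have : rho ^+ m * (rho * (1 - rho)) <= 1 * (1 - rho).
    rewrite mulrA ler_wpM2r ?(ltW ir0)// -exprSr exprn_ile1// ltW//.
  rewrite exprS -natr1; lra.
by apply: (le_trans (key k)); rewrite gerBl exprn_ge0// ltW.
Qed.

(** Split rho^k as the square of sqrt rho^k: one factor absorbs k, the other k^m. *)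
Lemma pow_geometric_bounded (R : realType) (m : nat) (rho : R) : 0 < rho < 1 ->
  exists2 B : R, 0 < B & forall k : nat, k%:R ^+ m * rho ^+ k <= B.
Proof.
elim: m rho => [|m IH] rho r01.
  exists 1 => // k; rewrite expr0 mul1r; case/andP: r01 => r0 r1.
  by rewrite exprn_ile1// ltW.
have s01 : 0 < Num.sqrt rho < 1.
  by case/andP: r01 => r0 r1; rewrite sqrtr_gt0 r0 /= -[ltRHS]sqrtr1 ltr_sqrt.
have [B B0 hB] := IH _ s01; have [D D0 hD] := natmul_geometric_bounded s01.
exists (D * B); first exact: mulr_gt0.
move=> k; have -> : rho ^+ k = Num.sqrt rho ^+ k * Num.sqrt rho ^+ k.
  by rewrite -exprMn -expr2 sqr_sqrtr// ltW//; case/andP: r01.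
rewrite exprS mulrACA; case/andP: s01 => s0 _.
by apply: ler_pM; rewrite ?mulr_ge0 ?exprn_ge0// ltW.
Qed.

Lemma geometric_decay_pow (R : realType) (u : nat -> R) (m : nat) :
  geometric_decay u ->
  exists2 B : R, 0 < B & forall k, (1 <= k)%N -> `|u k| <= B * k%:R ^- m.
Proof.
move=> [C [rho [C0 r01 hu]]]; have [B B0 hB] := pow_geometric_bounded m r01.
exists (C * B); first exact: mulr_gt0.
move=> k k1; have km : 0 < k%:R ^+ m :> R by rewrite exprn_gt0// ltr0n.
rewrite ler_pdivlMr// mulrC (le_trans (ler_wpM2l (ltW km) (hu k k1)))//.
by rewrite mulrCA ler_wpM2l// ltW.
Qed.

Lemma pow_bound_bigO (R : realType) (u : nat -> R) (m : nat) (B : R) :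
  0 < B -> (forall k, (1 <= k)%N -> `|u k| <= B * k%:R ^- m) ->
  u =O_\oo (fun k : nat => k%:R ^- m : R).
Proof.
move=> B0 hu; apply/eqO_exP; exists B => //; near=> k.
apply: (le_trans (hu k _)); first by near: k; exists 1%N.
by rewrite ler_wpM2l ?ler_norm// ltW.
Unshelve. all: by end_near. Qed.

Lemma geometric_decay_littleo (R : realType) (u : nat -> R) :
  geometric_decay u -> u =o_\oo (fun k : nat => k%:R^-1 : R).
Proof.
move=> /(geometric_decay_pow 2)[B B0 hu]; apply/eqoP => e e0.
have /cvgr0Pnorm_le /(_ e e0) hB := cvg_div_nat B.
near=> k; have k1 : (1 <= k)%N by near: k; exists 1%N.
apply: (le_trans (hu k k1)); rewrite expr2 invfM mulrA.
rewrite [X in _ <= _ * X]ger0_norm ?invr_ge0//.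
apply: ler_wpM2r; first by rewrite invr_ge0.
by apply: le_trans (ler_norm _) _; near: k.
Unshelve. all: by end_near. Qed.

(** One factor u k absorbs k^2, and the remaining one is summable. *)
Lemma geometric_decay_series (R : realType) (u : nat -> R) :
  geometric_decay u ->
  (\sum_(1 <= k <oo) (k%:R ^+ 2 * u k ^+ 2)%:E < +oo)%E.
Proof.
move=> hu; have [B B0 hB] := geometric_decay_pow 2 hu.
have [C [rho [C0 /andP[r0 r1] hC]]] := hu.
have ir0 : 0 < 1 - rho by rewrite subr_gt0.
apply: (@le_lt_trans _ _ (B * C / (1 - rho))%:E); last exact: ltry.
apply: lime_le.
  apply: is_cvg_nneseries => k _ _.
  by rewrite lee_fin -exprMn sqr_ge0.
apply: nearW => n; rewrite sumEFin lee_fin.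
have term k : (1 <= k)%N -> k%:R ^+ 2 * u k ^+ 2 <= B * C * rho ^+ k.
  move=> k1; have k2 : 0 < k%:R ^+ 2 :> R by rewrite exprn_gt0// ltr0n.
  rewrite -(real_normK (num_real (u k))) [_ ^+ 2 in leLHS]expr2 mulrA -[leRHS]mulrA.
  apply: ler_pM; rewrite ?mulr_ge0 ?exprn_ge0 ?hC//.
  have := hB k k1; rewrite ler_pdivlMr// mulrC//.
apply: (@le_trans _ _ (\sum_(1 <= k < n) B * C * rho ^+ k)).
  by apply: ler_sum_nat => k /andP[k1 _]; exact: term.
rewrite -mulr_sumr ler_wpM2l//; first by rewrite mulr_ge0// ltW.
rewrite -[leRHS]mul1r ler_pdivlMr//.
have : (\sum_(1 <= k < n) rho ^+ k) * (1 - rho) <= 1 - rho ^+ n.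
  elim: n => [|[|n] IH].
  - by rewrite big_geq// mul0r expr0 subrr.
  - by rewrite big_geq// mul0r expr1 ltW.
  - by rewrite big_nat_recr//= mulrDl [rho ^+ n.+2]exprSr; move: IH; lra.
by move/le_trans; apply; rewrite gerBl exprn_ge0// ltW.
Qed.

Lemma running_min_le (R : realType) (u : nat -> R) (k : nat) :
  (1 <= k)%N -> running_min u k <= u k.
Proof.
move=> k1; rewrite /running_min; apply: (@bigmin_inf_seq _ _ _ _ _ k) => //.
by rewrite mem_index_iota k1 ltnSn.
Qed.

Lemma running_min_ge0 (R : realType) (u : nat -> R) (k : nat) :
  (forall i, 0 <= u i) -> 0 <= running_min u k.
Proof. by move=> u0; apply: le_bigmin. Qed.

Lemma geometric_decay_running_min (R : realType) (u : nat -> R) :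
  geometric_decay u ->
  running_min (fun i => u i ^+ 2) =O_\oo (fun k : nat => k%:R ^- 3 : R).
Proof.
move=> hu; have : geometric_decay (fun i => u i ^+ 2).
  have [C [rho [C0 /andP[r0 r1] hC]]] := hu.
  apply: (@geometric_decay_le _ u _ C) => // k k1.
  rewrite normrX expr2 ler_wpM2r// (le_trans (hC k k1))//.
  by rewrite ler_piMr ?(ltW C0)// exprn_ile1// ltW.
move=> /(geometric_decay_pow 3)[B B0 hB]; apply: (pow_bound_bigO B0) => k k1.
apply: le_trans (hB k k1); rewrite !ger0_norm ?sqr_ge0//.
  exact: (@running_min_le _ (fun i => u i ^+ 2)).
by apply: running_min_ge0 => i; exact: sqr_ge0.
Qed.

(** * Spectral decomposition of the scheme *)

(** For the limiting matrix, D < 1 and 1 - t + D = q > 0 hold automatically, so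
that the only binding condition is positivity of the characteristic
polynomial at -1. *)
Lemma schur_modeP (R : realType) (alpha beta s lam : R) :
  0 <= beta -> 0 < s -> 0 < lam -> s * lam <= 1 ->
  schur_stable (mode_mx_lim alpha beta s lam) <->
  2 * (beta * lam * Num.sqrt s) * (1 - s * lam) < 4 - 3 * (s * lam).
Proof.
move=> b0 s0 l0 q1; rewrite mode_mx_limE.
set q := s * lam; set d := beta * lam * Num.sqrt s.
have q0 : 0 < q by rewrite mulr_gt0.
have d0 : 0 <= d by rewrite !mulr_ge0// ?sqrtr_ge0// ltW.
apply: (iff_trans (schur_companionP _ _)).
- by rewrite -/q in q1; nra.
- lra.
- by split=> h; lra.
Qed.

Lemma mode_dampingE (R : realType) (beta s lam : R) :
  0 < s -> beta * lam * Num.sqrt s = beta / Num.sqrt s * (s * lam).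
Proof.
move=> s0; have r0 : Num.sqrt s != 0 by rewrite gt_eqF// sqrtr_gt0.
have := sqr_sqrtr (ltW s0); move: (Num.sqrt s) r0 => r r0 <-.
by field.
Qed.

(** The threshold at the extreme value q = s L gives the stability condition of
every mode up to L. *)
Lemma threshold_eigenvalue (R : realType) (L beta s lam : R) :
  0 < s -> s * L <= 1 -> 0 < lam -> lam <= L ->
  beta / Num.sqrt s < threshold (s * L) ->
  2 * (beta * lam * Num.sqrt s) * (1 - s * lam) < 4 - 3 * (s * lam).
Proof.
move=> s0 p1 l0 lL hb; rewrite mode_dampingE//.
by apply: threshold_lower_mode hb; rewrite ?mulr_gt0// ler_wpM2l// ltW.
Qed.

Lemma eigenvalue_scalar_mx (R : realType) n (a : R) :
  (1 <= n)%N -> eigenvalue (a%:M : 'M[R]_n) a.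
Proof.
move=> n1; apply/eigenvalueP; exists (const_mx 1); first by rewrite mul_mx_scalar.
apply/eqP => /rowP/(_ (Ordinal n1)); rewrite !mxE => /eqP; by rewrite oner_eq0.
Qed.

(** Scalar matrices already force the threshold: test with eigenvalue L when
s L <= 2/3, and otherwise with 2 / (3 s), where the mode has q = 2/3, the
minimizer of the stability bound. *)
Lemma schur_uniform_threshold (R : realType) (n : nat) (L alpha s beta : R) :
  (1 <= n)%N -> 0 < L -> 0 < s -> s * L <= 1 -> 0 <= beta ->
  (forall Q : 'M[R]_n, Q^T = Q -> psdmx Q -> opnorm Q <= L ->
    forall lam : R, eigenvalue Q lam -> 0 < lam ->
      schur_stable (mode_mx_lim alpha beta s lam)) ->
  beta / Num.sqrt s < threshold (s * L).
Proof.
move=> n1 L0 s0 p1 b0 h; set b := beta / Num.sqrt s.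
have mode lam : 0 < lam -> lam <= L ->
    2 * (b * (s * lam)) * (1 - s * lam) < 4 - 3 * (s * lam).
  move=> l0 lL; rewrite -mode_dampingE// -schur_modeP//; last first.
    by apply: le_trans p1; rewrite ler_wpM2l// ltW.
  apply: (h lam%:M) => //.
  - by rewrite tr_scalar_mx.
  - by move=> v; rewrite mul_scalar_mx dotvZl mulr_ge0 ?dotv_ge0// ltW.
  - by apply: le_trans lL; apply: opnorm_scalar_le; exact: ltW.
  - exact: eigenvalue_scalar_mx.
have p0 : 0 < s * L by rewrite mulr_gt0.
rewrite /threshold; case: ifPn => [p23|].
  rewrite ltr_pdivlMr; last by rewrite !mulr_gt0// subr_gt0; lra.
  by have := mode L L0 (lexx L); lra.
rewrite -ltNge => p23.
have := mode (2 / 3 / s).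
have -> : s * (2 / 3 / s) = 2 / 3 by field; rewrite gt_eqF.
by rewrite !divr_gt0// ler_pdivrMr// (mulrC L) => /(_ isT (ltW p23)); lra.
Qed.

Lemma diagonalized_coord (R : realType) n (P Q : 'M[R]_n) (d : 'rV[R]_n) i
    (v : 'cV[R]_n) :
  P *m Q = diag_mx d *m P -> (P *m (Q *m v)) i 0 = d 0 i * (P *m v) i 0.
Proof. by move=> PQ; rewrite mulmxA PQ -mulmxA mul_diag_mx mxE. Qed.

Lemma diagonalized_eigenvalue (R : realType) n (P Q : 'M[R]_n) (d : 'rV[R]_n) i :
  P \in unitmx -> P *m Q = diag_mx d *m P -> eigenvalue Q (d 0 i).
Proof.
move=> uP PQ; apply/eigenvalueP; exists (row i P).
  by rewrite -row_mul PQ row_mul row_diag_mx -scalemxAl -rowE.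
apply/eqP => P0; have := congr1 (mulmx^~ (invmx P)) P0.
rewrite -row_mul mulmxV// mul0mx => /rowP/(_ i); rewrite !mxE eqxx => /eqP.
by rewrite oner_eq0.
Qed.

(** The gradient of the quadratic is linear, so the scheme commutes with taking a
coordinate in which Q is diagonal. *)
Lemma IGAHD_mode_scheme (R : realType) n (alpha beta s : R) (Q P : 'M[R]_n)
    (d : 'rV[R]_n) (xstar x0 x1 : 'cV[R]_n) (fstar : R) (x y : nat -> 'cV[R]_n) i :
  Q^T = Q -> P *m Q = diag_mx d *m P ->
  IGAHD (quadf Q xstar fstar) alpha beta s x0 x1 x y ->
  mode_scheme alpha beta s (d 0 i)
    (fun k => (P *m (x k - xstar)) i 0) (fun k => (P *m (y k - xstar)) i 0).
Proof.
move=> symQ PQ [_ _ hxy] k k1; have [yE xE] := hxy k k1.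
rewrite !grad_quadf// in yE xE; split; last first.
  rewrite xE addrAC mulmxBr -scalemxAr [LHS]mxE [X in _ + X]mxE [in X in _ - X]mxE.
  by rewrite (diagonalized_coord _ _ PQ).
have -> : y k - xstar = (x k - xstar)
    + (1 - alpha / k%:R) *: ((x k - xstar) - (x k.-1 - xstar))
    - (beta * Num.sqrt s) *: (Q *m (x k - xstar) - Q *m (x k.-1 - xstar))
    - (beta * Num.sqrt s / k%:R) *: (Q *m (x k.-1 - xstar)).
  have -> : (x k - xstar) - (x k.-1 - xstar) = x k - x k.-1.
    by rewrite opprB addrA subrK.
  by rewrite yE 3!(addrAC _ _ (- xstar)).
move: (x k - xstar) (x k.-1 - xstar) => u v.
have cD (a b : 'cV[R]_n) : (P *m (a + b)) i 0 = (P *m a) i 0 + (P *m b) i 0.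
  by rewrite mulmxDr mxE.
have cN (a : 'cV[R]_n) : (P *m (- a)) i 0 = - (P *m a) i 0.
  by rewrite mulmxN mxE.
have cZ c (a : 'cV[R]_n) : (P *m (c *: a)) i 0 = c * (P *m a) i 0.
  by rewrite -scalemxAr mxE.
by rewrite !(cD, cN, cZ) !(diagonalized_coord _ _ PQ).
Qed.

Lemma geometric_decay_enorm (R : realType) n (P : 'M[R]_n) (v : nat -> 'cV[R]_n) :
  P \in unitmx -> (forall i, geometric_decay (fun k => (P *m v k) i 0)) ->
  geometric_decay (fun k => enorm (v k)).
Proof.
move=> uP /geometric_decay_sum hv.
have [M M0 hM] := enorm_mulmx_bounded (invmx P).
apply: (geometric_decay_le (M := M) _ hv) => k _.
rewrite ger0_norm ?enorm_ge0// -{1}(mulKmx uP (v k)).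
apply: (le_trans (hM _)); apply: ler_wpM2l => //.
exact: le_trans (enorm_le_sum _) (ler_norm _).
Qed.

Lemma cvg_colP (R : realType) n (x : nat -> 'cV[R]_n) (l : 'cV[R]_n) :
  (forall i, x k i 0 @[k --> \oo] --> l i 0) -> x k @[k --> \oo] --> l.
Proof.
move=> h; apply/cvgrPdist_lt => e e0.
have hall : \forall k \near \oo, forall i, `|l i 0 - x k i 0| < e.
  by apply: filter_forall => i; have /cvgrPdist_lt := h i; apply.
near=> k; rewrite /Num.norm/= mx_normrE.
apply/bigmax_ltP; split=> // -[i j] _; rewrite !mxE/= (ord1 j).
by move: i {j}; near: k.
Unshelve. all: by end_near. Qed.

Lemma cvg_mulmx (R : realType) n (A : 'M[R]_n) (w : nat -> 'cV[R]_n) (l : 'cV[R]_n) :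
  (forall i, w k i 0 @[k --> \oo] --> l i 0) ->
  A *m w k @[k --> \oo] --> A *m l.
Proof.
move=> h; apply: cvg_colP => i; rewrite mxE.
under eq_fun do rewrite mxE.
apply: cvg_big => [|j _]; last by apply: cvgM; [exact: cvg_cst|exact: h].
exact: add_continuous.
Qed.

(** Positive modes decay geometrically and kernel modes converge. The gradient
sees only the former; the limit of x is the point whose positive coordinates
are those of xstar and whose kernel coordinates are those of x 0. *)
Lemma IGAHD_quadratic_asymptotics (R : realType) (n : nat) (L alpha s beta : R)
    (Q : 'M[R]_n) (xstar x0 x1 : 'cV[R]_n) (fstar : R) (x y : nat -> 'cV[R]_n) :
  3 <= alpha -> 0 < s -> s * L <= 1 -> 0 <= beta ->
  beta / Num.sqrt s < threshold (s * L) ->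
  Q^T = Q -> psdmx Q -> opnorm Q <= L ->
  IGAHD (quadf Q xstar fstar) alpha beta s x0 x1 x y ->
  [/\ geometric_decay (fun k => enorm (Q *m (x k - xstar))),
      geometric_decay (fun k => enorm (Q *m (y k - xstar))) &
      exists2 xbar, Q *m (xbar - xstar) = 0 & x k @[k --> \oo] --> xbar].
Proof.
move=> ha s0 p1 b0 hb symQ psdQ QL hxy.
have [P [d uP PQ]] := symmetric_diagonalizable symQ.
pose xi i k := (P *m (x k - xstar)) i 0.
pose eta i k := (P *m (y k - xstar)) i 0.
have hmode i : mode_scheme alpha beta s (d 0 i) (xi i) (eta i).
  exact: IGAHD_mode_scheme hxy.
have dE i : 0 <= d 0 i <= L.
  have ev := diagonalized_eigenvalue i uP PQ.
  by rewrite (psd_eigenvalue_ge0 symQ)//= (le_trans (eigenvalue_le_opnorm symQ ev)).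
have decay i : d 0 i != 0 -> geometric_decay (xi i) /\ geometric_decay (eta i).
  move=> di; have /andP[d0 dL] := dE i.
  have dp : 0 < d 0 i by rewrite lt_neqAle eq_sym di.
  apply: positive_mode_decay (hmode i) => //.
    by apply: le_trans p1; rewrite ler_wpM2l// ltW.
  exact: threshold_eigenvalue hb.
have decay0 : geometric_decay (fun=> 0 : R).
  exists 1, (1 / 2); split => //; first by apply/andP; split; lra.
  by move=> k _; rewrite normr0 mul1r exprn_ge0// divr_ge0.
have gradE (z : nat -> 'cV[R]_n) i :
    (d 0 i != 0 -> geometric_decay (fun k => (P *m (z k - xstar)) i 0)) ->
    geometric_decay (fun k => (P *m (Q *m (z k - xstar))) i 0).
  move=> hz; have [d0|d0] := eqVneq (d 0 i) 0.
    apply: (@geometric_decay_le _ _ _ 0 _ decay0) => k _.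
    by rewrite (diagonalized_coord _ _ PQ) d0 mul0r normr0 mulr0.
  apply: (@geometric_decay_le _ _ _ `|d 0 i| _ (hz d0)) => k _.
  by rewrite (diagonalized_coord _ _ PQ) normrM.
split.
- by apply: (geometric_decay_enorm uP) => i; apply: gradE => /decay[].
- by apply: (geometric_decay_enorm uP) => i; apply: gradE => /decay[].
pose l := \col_i (if d 0 i == 0 then xi i 0%N else 0).
exists (xstar + invmx P *m l).
  rewrite addrC addKr; apply: (can_inj (mulKmx uP)).
  apply/colP => i; rewrite (diagonalized_coord _ _ PQ) mulKVmx// mulmx0 !mxE.
  by case: eqP => [->|_]; rewrite ?mul0r ?mulr0.
have -> : x = fun k => xstar + invmx P *m (P *m (x k - xstar)).
  by apply/funext => k; rewrite mulKmx// addrC subrK.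
apply: cvgD; first exact: cvg_cst.
apply: cvg_mulmx => i; rewrite mxE; case: eqP => [d0|/eqP d0].
  by have := hmode i; rewrite d0; exact: kernel_mode_cvg.
by apply: geometric_decay_cvg0; have [] := decay i d0.
Qed.

(** * Stability threshold and rates of convergence *)

Theorem proposition6p2 (R : realType) (n : nat) (L alpha s beta : R)
    (hn : (1 <= n)%N) (hL : 0 < L) (halpha : 3 <= alpha)
    (hs0 : 0 < s) (hsL : s <= 1 / L) (hbeta : 0 <= beta) :
  ((forall Q : 'M[R]_n, Q^T = Q -> psdmx Q -> opnorm Q <= L ->
      forall lam : R, eigenvalue Q lam -> 0 < lam ->
        schur_stable (mode_mx_lim alpha beta s lam))
   <-> beta / Num.sqrt s < threshold (s * L))
  /\
  (beta / Num.sqrt s < threshold (s * L) ->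
   forall Q : 'M[R]_n, Q^T = Q -> psdmx Q -> opnorm Q <= L ->
   forall (xstar : 'cV[R]_n) (fstar : R) (x0 x1 : 'cV[R]_n)
     (x y : nat -> 'cV[R]_n),
   let f := quadf Q xstar fstar in
   IGAHD f alpha beta s x0 x1 x y ->
   (exists (C rho : R) (k0 : nat),
      [/\ 0 < C, 0 < rho < 1, (1 <= k0)%N &
        forall k : nat, (k0 <= k)%N ->
          0 <= f (x k) - fstar <= C * rho ^+ (2 * k)
          /\ enorm (grad f (x k)) + enorm (grad f (y k)) <= C * rho ^+ k])
   /\ (fun k : nat => f (x k) - fstar) =O_\oo (fun k : nat => k%:R ^- 2 : R)
   /\ (\sum_(1 <= k <oo) (k%:R ^+ 2 * enorm (grad f (x k)) ^+ 2)%:E < +oo)%E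
   /\ (\sum_(1 <= k <oo) (k%:R ^+ 2 * enorm (grad f (y k)) ^+ 2)%:E < +oo)%E
   /\ (fun k : nat => enorm (grad f (x k))) =o_\oo (fun k : nat => k%:R^-1 : R)
   /\ (fun k : nat => enorm (grad f (y k))) =o_\oo (fun k : nat => k%:R^-1 : R)
   /\ running_min (fun i : nat => enorm (grad f (x i)) ^+ 2)
        =O_\oo (fun k : nat => k%:R ^- 3 : R)
   /\ running_min (fun i : nat => enorm (grad f (y i)) ^+ 2)
        =O_\oo (fun k : nat => k%:R ^- 3 : R)
   /\ (exists xbar : 'cV[R]_n,
         (forall z : 'cV[R]_n, f xbar <= f z)
         /\ x k @[k --> \oo] --> xbar)).
Proof.
have p1 : s * L <= 1 by move: hsL; rewrite ler_pdivlMr.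
split; first split.
- exact: schur_uniform_threshold.
- move=> hb Q symQ psdQ QL lam ev l0.
  have lL : lam <= L by exact: le_trans (eigenvalue_le_opnorm symQ ev) QL.
  rewrite schur_modeP//; first exact: threshold_eigenvalue hb.
  by apply: le_trans p1; rewrite ler_wpM2l// ltW.
move=> hb Q symQ psdQ QL xstar fstar x0 x1 x y f hxy.
have [decx decy [xbar gbar cvgx]] :=
  IGAHD_quadratic_asymptotics halpha hs0 p1 hbeta hb symQ psdQ QL hxy.
have gE z : grad f z = Q *m (z - xstar) by exact: grad_quadf.
have fE z : f z - fstar = 1 / 2 * dotv (Q *m (z - xstar)) (z - xstar).
  by rewrite /f /quadf addrK.
have f0 z : 0 <= f z - fstar by rewrite fE mulr_ge0// divr_ge0.
have decG := geometric_decayD decx decy.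
have [C [rho [C0 r01 hC]]] := decG.
have [M M0 hM] := quad_le_grad symQ.
have fle k : (1 <= k)%N -> f (x k) - fstar <= M * C ^+ 2 * rho ^+ (2 * k).
  move=> k1; rewrite fE; apply: (@le_trans _ _ (M * enorm (Q *m (x k - xstar)) ^+ 2)).
    apply: le_trans (hM _); rewrite ler_piMl ?psdQ//; lra.
  rewrite -mulrA ler_wpM2l// mulnC exprM -exprMn.
  rewrite lerXn2r ?nnegrE ?enorm_ge0//.
    by rewrite mulr_ge0 ?exprn_ge0 ?ltW//; case/andP: r01.
  apply: le_trans (hC k k1); apply: le_trans (ler_norm _).
  by rewrite lerDl enorm_ge0.
split.
  exists (C + M * C ^+ 2), rho, 1%N; split=> //.
    by rewrite ltr_wpDr// mulr_ge0// exprn_ge0// ltW.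
  have r0 : 0 <= rho by case/andP: r01 => /ltW.
  move=> k k1; split.
    rewrite f0/= (le_trans (fle k k1))// ler_wpM2r ?exprn_ge0//.
    by rewrite lerDr ltW.
  rewrite !gE; apply: le_trans (ler_norm _) _; apply: le_trans (hC k k1) _.
  by rewrite ler_wpM2r ?exprn_ge0// lerDl mulr_ge0// exprn_ge0// ltW.
split.
  have : geometric_decay (fun k => f (x k) - fstar).
    exists (C + M * C ^+ 2), (rho ^+ 2); split.
    - by rewrite ltr_wpDr// mulr_ge0// exprn_ge0// ltW.
    - by case/andP: r01 => r0 r1; rewrite exprn_gt0// expr_lt1// ltW.
    - move=> k k1; rewrite ger0_norm// -exprM (le_trans (fle k k1))//.
      rewrite ler_wpM2r ?exprn_ge0//; first by case/andP: r01 => /ltW.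
      by rewrite lerDr ltW.
  by move=> /(geometric_decay_pow 2)[B B0 hB]; exact: pow_bound_bigO B0 hB.
do 2 (split; first by under eq_eseriesr do rewrite gE; exact: geometric_decay_series).
do 2 (split; first by under eq_fun do rewrite gE; exact: geometric_decay_littleo).
do 2 (split; first by under eq_fun do rewrite gE; exact: geometric_decay_running_min).
exists xbar; split=> // z.
have : f xbar - fstar <= f z - fstar.
  by apply: le_trans (f0 z); rewrite fE gbar /dotv big1 ?mulr0// => i _; rewrite mxE mul0r.
by rewrite lerD2r.
Qed.
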